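(* Let $\mathcal{X}$ be a nonempty set, $\mathcal{F}$ a reproducing kernel Hilbert space of real functions on $\mathcal{X}$ with feature map $\Phi:\mathcal{X}\to\mathcal{F}$ such that $\|\Phi(x)\|\le R$ for all $x\in\mathcal{X}$, for some $R>0$. Let $\mathcal{M}\subset\mathcal{F}$ be the convex hull of $\{\Phi(x):x\in\mathcal{X}\}$, let $\mu=\mathbb{E}_{p(x)}\Phi(x)$ be the mean element of a probability distribution $p$ on $\mathcal{X}$, and let $J(g)=\frac12\|g-\mu\|^2$ for $g\in\mathcal{M}$. Let $(x_t)_{t\ge 1}$ be a sequence in $\mathcal{X}$ and $(w_t)_{t\ge1}$ a sequence in $\mathcal{F}$, and set $g_t=\mu-\frac{w_t}{t}$ for $t\ge1$. Then the herding recursion $$x_{t+1}\in\arg\max_{x\in\mathcal{X}}\langle w_t,\Phi(x)\rangle,\qquad w_{t+1}=w_t+\mu-\Phi(x_{t+1})\qquad\text{for all } t\ge1$$ holds if and only if $(g_t)_{t\ge 1}$ follows the conditional gradient recursion for minimizing $J$ over $\mathcal{M}$ with step size $\rho_t=\frac{1}{t+1}$ and linear minimizers $\bar g_{t+1}=\Phi(x_{t+1})$, that is, $$\bar g_{t+1}=\Phi(x_{t+1})\in\arg\min_{g\in\mathcal{M}}\langle g_t-\mu,g\rangle,\qquad g_{t+1}=(1-\rho_t)g_t+\rho_t\bar g_{t+1}\qquad\text{for all } t\ge1.$$ Moreover, if these recursions hold and $g_1=\Phi(x_1)$ (equivalently $w_1=\mu-\Phi(x_1)$), then $g_t=\frac1t\sum_{u=1}^t\Phi(x_u)$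 for all $t\ge1$.
   Context: Elements $f\in\mathcal{F}$ are identified with real functions on $\mathcal{X}$ by $f(x)=\langle f,\Phi(x)\rangle$. The mean element $\mu=\mathbb{E}_{p(x)}\Phi(x)\in\mathcal{F}$ is characterized by $\langle\mu,f\rangle=\mathbb{E}_{p(x)}f(x)$ for all $f\in\mathcal{F}$ (assumed well defined). For minimizing a smooth convex function $J$ over a convex set $\mathcal{M}$, a conditional gradient (Frank-Wolfe) iteration from $g_t$ picks $\bar g_{t+1}$ minimizing $g\mapsto\langle J'(g_t),g\rangle$ over $\mathcal{M}$ and sets $g_{t+1}=(1-\rho_t)g_t+\rho_t\bar g_{t+1}$ with $\rho_t\in[0,1]$. Here $J'(g)=g-\mu$. *)

(* Defs.v *)
From HB Require Import structures.
From mathcomp Require Import all_boot all_order all_algebra.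
From mathcomp Require Import sesquilinear.
From mathcomp Require Import all_classical all_reals all_analysis.
Set Implicit Arguments.
Unset Strict Implicit.
Unset Printing Implicit Defensive.
Import Order.TTheory GRing.Theory Num.Theory.
Import numFieldNormedType.Exports.
Local Open Scope classical_set_scope.
Local Open Scope ring_scope.

Definition argmin (T : Type) (R : realType) (A : set T) (f : T -> R) : set T :=
  [set a | A a /\ forall b, A b -> f a <= f b].

Definition argmax (T : Type) (R : realType) (A : set T) (f : T -> R) : set T :=
  [set a | A a /\ forall b, A b -> f b <= f a].

Definition convex_hull (R : realType) (F : lmodType R) (A : set F) : set F :=
  smallest (@convex_set R F) A.

(* The function on X identified with f : F, i.e. f(x) = <f, Phi(x)>. *)
Definition feval (R : realType) (F : lmodType R) (dot : {dot F for idfun})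
    (X : Type) (Phi : X -> F) (f : F) : X -> R :=
  fun x => dot f (Phi x).

(* The completeNormedModType F is a Hilbert space for dot, and its elements are
   determined by the functions they induce on X, so that F is a Hilbert space
   of real functions on X with reproducing kernel
   (x, y) |-> <Phi(x), Phi(y)>. *)
Record is_rkhs (R : realType) (F : completeNormedModType R)
    (dot : {dot F for idfun}) (X : Type) (Phi : X -> F) : Prop := {
  rkhs_norm : forall f : F, `|f| ^+ 2 = dot f f ;
  rkhs_inj : injective (feval dot Phi)
}.

Definition is_mean_element (d : measure_display) (X : measurableType d)
    (R : realType) (F : lmodType R) (dot : {dot F for idfun})
    (Phi : X -> F) (p : probability X R) (mu : F) : Prop :=
  forall f : F, p.-integrable [set: X] (EFin \o feval dot Phi f) /\
    ((dot mu f)%:E = 'E_p[feval dot Phi f])%E.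

Definition is_gradient (R : realType) (F : completeNormedModType R)
    (dot : {dot F for idfun}) (J : F -> R) (J' : F -> F) : Prop :=
  forall g : F, is_diff g J (dot (J' g)).

(* Sequences are indexed from 1: the values at 0 are irrelevant. *)
Definition conditional_gradient (R : realType) (F : completeNormedModType R)
    (dot : {dot F for idfun}) (J : F -> R) (J' : F -> F) (M : set F)
    (rho : nat -> R) (gbar g : nat -> F) : Prop :=
  is_gradient dot J J' /\
  forall t : nat, (1 <= t)%N ->
    [/\ 0 <= rho t <= 1,
        argmin M (fun h => dot (J' (g t)) h) (gbar t.+1) &
        g t.+1 = (1 - rho t) *: g t + rho t *: gbar t.+1].

Definition herding (R : realType) (F : lmodType R) (dot : {dot F for idfun})
    (X : Type) (Phi : X -> F) (mu : F) (x : nat -> X) (w : nat -> F) : Prop :=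
  forall t : nat, (1 <= t)%N ->
    argmax [set: X] (fun y => dot (w t) (Phi y)) (x t.+1) /\
    w t.+1 = w t + mu - Phi (x t.+1).

(* Main.v *)
(* With w_t = t (mu - g_t), the linear form of the Frank-Wolfe step is
   <g_t - mu, .> = - <w_t, .> / t, so minimizing it is maximizing <w_t, .>; a
   linear form is minimized over a convex hull at a generator exactly when that
   generator minimizes it among the generators, because its superlevel sets are
   convex. The updates of g and w are the same equation up to the factor t + 1,
   and in the form (t + 1) g_{t+1} = t g_t + Phi (x_{t+1}) the update of g sums
   to the average of the Phi (x_u). *)
Require Import Defs.
From HB Require Import structures.
From mathcomp Require Import all_boot all_order all_algebra.
From mathcomp Require Import ring lra.
From mathcomp Require Import sesquilinear.
From mathcomp Require Import all_classical all_reals all_analysis.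
Set Implicit Arguments.
Unset Strict Implicit.
Unset Printing Implicit Defensive.
Import Order.TTheory GRing.Theory Num.Theory.
Import numFieldNormedType.Exports.
Local Open Scope classical_set_scope.
Local Open Scope ring_scope.

Section InnerProduct.
Variables (R : realType) (F : completeNormedModType R) (dot : {dot F for idfun}).
Hypothesis normE : forall f : F, `|f| ^+ 2 = dot f f.

Lemma dotC (a b : F) : dot a b = dot b a.
Proof. by rewrite hermC expr0 mul1r. Qed.

Lemma normD_sqr (a b : F) :
  `|a + b| ^+ 2 = `|a| ^+ 2 + 2 * dot a b + `|b| ^+ 2.
Proof. by rewrite !normE linearDl !linearDr /= (dotC b a); ring. Qed.

(* Cauchy-Schwarz is read off the triangle inequality, which `|.| satisfies as
   the norm of F. *)
Lemma le_dot_norm (a b : F) : dot a b <= `|a| * `|b|.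
Proof.
have : `|a + b| ^+ 2 <= (`|a| + `|b|) ^+ 2.
  by rewrite lerXn2r ?nnegrE ?addr_ge0 ?normr_ge0 // ler_normD.
by rewrite normD_sqr sqrrD -mulr_natl; lra.
Qed.

Lemma ler_norm_dot (a b : F) : `|dot a b| <= `|a| * `|b|.
Proof.
rewrite ler_norml le_dot_norm andbT lerNl -linearNl.
by rewrite (le_trans (le_dot_norm _ _)) // normrN.
Qed.

(** Expanding the square around [g - mu], the increment differs from its linear part by exactly half
    the squared norm of [h], which is [o(h)]. Cauchy-Schwarz makes the linear part continuous. *)
Lemma is_gradient_half_sqnorm (mu : F) :
  is_gradient dot (fun h : F => 2^-1 * `|h - mu| ^+ 2) (fun h => h - mu).
Proof.
move=> g.
(* The canonical linear structure of [dot (g - mu)] is for the scaling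
   [idfun \; *%R], while [diff_unique] expects [*:%R]. *)
have dlin : linear (dot (g - mu) : F -> R^o).
  by move=> k u v; rewrite linearPr.
pose dL := GRing.isLinear.Build R F R^o *:%R _ dlin.
pose D : {linear F -> R} := HB.pack (dot (g - mu) : F -> R) dL.
have Dc : continuous (D : F -> R).
  apply: bounded_linear_continuous; apply/linear_boundedP.
  near=> r => h; apply: le_trans (ler_norm_dot _ _) _.
  by apply: ler_wpM2r => //; near: r; apply: nbhs_pinfty_ge; rewrite num_real.
have DE : (fun h : F => 2^-1 * `|h - mu| ^+ 2 : R) \o shift g =
    cst (2^-1 * `|g - mu| ^+ 2) + D +o_ 0 id.
  apply/eqaddoP => e e0; near=> h.
  rewrite /= !fctE /= -addrA [h + _]addrC (normD_sqr (g - mu)).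
  rewrite [X in `|X|](_ : _ = 2^-1 * `|h| * `|h|); last by field.
  rewrite ger0_norm ?mulr_ge0 // ?invr_ge0 // ler_wpM2r //.
  rewrite ler_pdivrMl //; near: h.
  apply: nbhs0_le; exact: mulr_gt0.
have dE := diff_unique Dc DE.
by apply: DiffDef => //; apply/diff_locallyP; rewrite dE.
Unshelve. all: by end_near. Qed.

Lemma convex_set_dot_ge (c : F) (k : R) :
  convex_set ([set h | k <= dot c h] : set (convex_lmodType F)).
Proof.
apply/convex_setW => a b; rewrite !inE /= => ka kb l l0 l1.
(* The abstract convex combination unfolds to this explicit one. *)
rewrite inE /=; change (k <= dot c (l%:num *: a + (1 - l%:num) *: b)).
by rewrite linearDr !linearZr_LR /=; nra.
Qed.

Lemma argmin_convex_hull (c : F) (A : set F) (a : F) : A a ->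
  argmin (convex_hull A) (dot c) a <-> argmin A (dot c) a.
Proof.
move=> Aa; split=> -[_ ale]; split=> //.
- by move=> b Ab; apply: ale; apply: sub_gen_smallest.
- exact: sub_gen_smallest.
(* The superlevel set at [k = dot c a] is convex and contains [A], hence contains the hull. *)
- by apply: smallest_sub; first exact: convex_set_dot_ge.
Qed.

End InnerProduct.

Lemma argmin_scale_neg (F : Type) (R : realType) (A : set F) (f f' : F -> R)
    (k : R) : 0 < k -> (forall h, f' h = - (k * f h)) ->
  argmin A f' = argmax A f.
Proof.
move=> k0 ff'; apply/seteqP; split=> a [Aa H]; split=> // b Ab; have := H b Ab;
  by rewrite !ff' lerN2 ler_pM2l.
Qed.

Lemma argmax_range (X T : Type) (R : realType) (Phi : X -> T) (f : T -> R)
    (y : X) :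
  argmax (range Phi) f (Phi y) <-> argmax [set: X] (f \o Phi) y.
Proof.
split=> -[_ H]; split=> //.
- by move=> z _; apply: H; exists z.
- by move=> _ [z _ <-]; exact: (H z).
Qed.

(** The right-hand side collapses to [mu - t.+1%:R^-1 *: (v + mu - f)], because
    [1 - 1/(t+1) = t/(t+1)] cancels the [1/t]; scaling by a nonzero factor is injective. *)
Lemma conditional_gradient_step (R : realType) (F : lmodType R) (t : nat)
    (mu v v' f : F) : (0 < t)%N ->
  mu - t.+1%:R^-1 *: v' =
    (1 - t.+1%:R^-1) *: (mu - t%:R^-1 *: v) + t.+1%:R^-1 *: f <->
  v' = v + mu - f.
Proof.
move=> t0.
have tn0 : t%:R != 0 :> R by rewrite pnatr_eq0 -lt0n.
have tn1 : t.+1%:R != 0 :> R by rewrite pnatr_eq0.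
have -> : (1 - t.+1%:R^-1) *: (mu - t%:R^-1 *: v) + t.+1%:R^-1 *: f =
          mu - t.+1%:R^-1 *: (v + mu - f).
  have -> : 1 - t.+1%:R^-1 = t.+1%:R^-1 * t%:R :> R.
    by rewrite -natr1; field; rewrite natr1.
  rewrite -scalerA scalerBr scalerA divff // scale1r.
  (* The lone [mu] becomes [(t+1)^-1 *: ((t+1) *: mu)], so that [(t+1)^-1] factors out of both
     sides. *)
  rewrite -{2}[mu](scalerK tn1) -scalerBr -scalerDr; congr (_ *: _).
  rewrite -natr1 scalerDl scale1r !opprD !opprK.
  by rewrite addrA; congr (_ + _); rewrite addrACA subrr addr0.
split=> [/addrI/oppr_inj/(scalerI _)|-> //].
by apply; rewrite invr_neq0.
Qed.

Theorem mainTheorem1 (R : realType) (d : measure_display)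
    (X : measurableType d) (F : completeNormedModType R)
    (dot : {dot F for idfun}) (Phi : X -> F)
    (hF : is_rkhs dot Phi)
    (B : R) (hB : 0 < B) (hPhi : forall y : X, `|Phi y| <= B)
    (p : probability X R) (mu : F) (hmu : is_mean_element dot Phi p mu)
    (x : nat -> X) (w g : nat -> F)
    (hg : forall t : nat, (1 <= t)%N -> g t = mu - t%:R^-1 *: w t) :
  let M := convex_hull (range Phi) in
  let J := fun h : F => 2^-1 * `|h - mu| ^+ 2 in
  let J' := fun h : F => h - mu in
  let rho := fun t : nat => t.+1%:R^-1 : R in
  [/\ herding dot Phi mu x w <->
        conditional_gradient dot J J' M rho (fun t => Phi (x t)) g,
      g 1%N = Phi (x 1%N) <-> w 1%N = mu - Phi (x 1%N) &
      herding dot Phi mu x w -> g 1%N = Phi (x 1%N) ->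
      forall t : nat, (1 <= t)%N ->
        g t = t%:R^-1 *: \sum_(1 <= u < t.+1) Phi (x u)].
Proof.
move=> M J J' rho.
have normE := rkhs_norm hF.
have argE t y : (1 <= t)%N ->
    argmin M (fun h => dot (J' (g t)) h) (Phi y) <->
    argmax [set: X] (fun z => dot (w t) (Phi z)) y.
  move=> t1; rewrite argmin_convex_hull; last by exists y.
  (* The factor is [1/t] since [g t - mu = - (w t / t)]. *)
  rewrite (@argmin_scale_neg _ _ _ (dot (w t)) _ t%:R^-1); last 2 first.
  - by rewrite invr_gt0 ltr0n.
  - by move=> h; rewrite /J' hg // addrAC subrr add0r linearNl linearZl_LR.
  exact: argmax_range.
have stepE t : (1 <= t)%N ->
    g t.+1 = (1 - rho t) *: g t + rho t *: Phi (x t.+1) <->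
    w t.+1 = w t + mu - Phi (x t.+1).
  by move=> t1; rewrite !hg //; exact: conditional_gradient_step.
have herdingE : herding dot Phi mu x w <->
    conditional_gradient dot J J' M rho (fun t => Phi (x t)) g.
  split=> [H|[_ H]].
    split=> [|t t1]; first exact: is_gradient_half_sqnorm.
    have [Ha Hs] := H t t1; split; [|exact/argE|exact/stepE].
    by rewrite invr_ge0 ler0n invf_le1 ?ltr0n // ler1n.
  move=> t t1; have [_ Ha Hs] := H t t1.
  by split; [exact/argE|exact/stepE].
split=> //.
  rewrite hg // invr1 scale1r; split=> [<-|->]; first by rewrite subKr.
  by rewrite subKr.
(* Index 0 is vacuous and the induction really starts at 1, with [g1]. *)
move=> /herdingE[_ H] g1; elim=> // -[|t] IH _.
  by rewrite big_nat1 invr1 scale1r.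
have [_ _ ->] := H t.+1 isT.
rewrite IH // [in RHS]big_nat_recr //= scalerDr scalerA; congr (_ *: _ + _).
(* The old terms keep equal weight: [(1 - 1/(t+2)) / (t+1) = 1/(t+2)]. *)
rewrite /rho -[t.+2%:R]natr1; field.
by rewrite (addrC 1 t%:R) !natr1 !pnatr_eq0.
Qed.
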